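(* Let $n,N\ge 1$ be integers and $\tau_0\in\mathbb{R}$. For $k=1,\dots,n$ let $G_k(t,u_{11},\dots,u_{1N},\dots,u_{n1},\dots,u_{nN})$ be a real-valued function on $(-\infty,\tau_0]\times\mathbb{R}^{nN}$, locally integrable in $t$ and continuous in $(u_{11},\dots,u_{nN})$. For $k=1,\dots,n$, $j=1,\dots,N$ let $\beta_{kj}$ be a real-valued locally measurable function on $(-\infty,\tau_0]$, and for $k=1,\dots,n$ let $s_k$ be a real-valued continuous function on $[\tau_0,+\infty)$. Assume: (L* ) there are locally integrable functions $h_1,\dots,h_n$ on $(-\infty,\tau_0]$ such that, for $k=1,\dots,n$, all $t\le\tau_0$ and all $u_{mj},v_{mj}\in\mathbb{R}$, $$|G_k(t,u_{11},\dots,u_{nN})-G_k(t,v_{11},\dots,v_{nN})|\le h_k(t)\sum_{m=1}^n\sum_{j=1}^N|u_{mj}-v_{mj}|;$$ (LI* ) for any locally measurable functions $\psi_{11},\dots,\psi_{1N},\dots,\psi_{n1},\dots,\psi_{nN}$ on $(-\infty,\tau_0]$, the superpositions $t\mapsto G_k(t,\psi_{11}(t),\dots,\psi_{nN}(t))$, $k=1,\dots,n$, are locally integrable on $(-\infty,\tau_0]$; (Adv) $\beta_{kj}(t)\ge t$ for all $t\le\tau_0$, $k=1,\dots,n$, $j=1,\dots,N$. Then the Cauchy co problem $$\phi_k'(t)=G_k\bigl(t,\phi_1(\beta_{11}(t)),\dots,\phi_1(\beta_{1N}(t)),\dots,\phi_n(\beta_{n1}(t)),\dots,\phi_n(\beta_{nN}(t))\bigr),\quad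 t\le\tau_0,\ k=1,\dots,n,$$ $$\phi_k(t)=s_k(t),\quad t\ge\tau_0,\ k=1,\dots,n,$$ has a unique solution.
   Context: A solution of the Cauchy co problem is a real-valued continuous vector function $(\phi_1(t),\dots,\phi_n(t))$ on $\mathbb{R}$ which is absolutely continuous on every compact subinterval of $(-\infty,\tau_0]$, satisfies the system of equations for almost every $t\in(-\infty,\tau_0]$, and satisfies the terminal conditions $\phi_k(t)=s_k(t)$ for all $t\ge\tau_0$, $k=1,\dots,n$. ''Locally measurable'' and ''locally integrable'' mean Lebesgue measurable, respectively Lebesgue integrable, on every compact subinterval. *)

(* Defs.v *)
From HB Require Import structures.
From mathcomp Require Import all_boot all_order all_algebra.
From mathcomp Require Import all_classical all_reals all_analysis.

Set Implicit Arguments.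
Unset Strict Implicit.
Unset Printing Implicit Defensive.

Import Order.TTheory GRing.Theory Num.Theory.
Import numFieldNormedType.Exports.

Local Open Scope classical_set_scope.
Local Open Scope ring_scope.

(* The real line with the sigma-algebra of Lebesgue-measurable sets, i.e. the
   domain of completed_lebesgue_measure.  The default sigma-algebra on R (and
   hence measurable_fun, lebesgue_measure, locally_integrable at R) is only the
   Borel one. *)
Notation lebesgueR R :=
  (caratheodory_type (mu_ext (wlength (@idfun R)))).

Section LocalNotions.
Context {R : realType}.
Implicit Types (D : set R) (f : R -> R).

Definition locally_lebesgue_measurable D f : Prop :=
  forall a b : R, `[a, b] `<=` D ->
    measurable_fun (`[a, b]%classic : set (lebesgueR R)) (f : lebesgueR R -> R).

(* Unlike the library's locally_integrable, the domain need not be open and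
   measurability is Lebesgue measurability. *)
Definition locally_lebesgue_integrable D f : Prop :=
  forall a b : R, `[a, b] `<=` D ->
    completed_lebesgue_measure.-integrable (`[a, b]%classic : set (lebesgueR R))
      (EFin \o f).

Definition absolutely_continuous_on (a b : R) f : Prop :=
  forall e : R, 0 < e -> exists2 d : R, 0 < d &
    forall (m : nat) (x y : 'I_m -> R),
      (forall i, [/\ a <= x i, x i <= y i & y i <= b]) ->
      trivIset [set: 'I_m] (fun i => `]x i, y i[%classic) ->
      \sum_(i < m) (y i - x i) < d ->
      \sum_(i < m) `|f (y i) - f (x i)| < e.

End LocalNotions.

Section CauchyCoProblem.
Context {R : realType} {n N : nat}.
Variables (tau0 : R) (G : 'I_n -> R -> 'M[R]_(n, N) -> R).
Variables (beta : 'I_n -> 'I_N -> R -> R) (s : 'I_n -> R -> R).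

(* Functions given on a half-line are total functions R -> R whose values
   off that half-line are never used. *)
Definition cauchy_co_solution (phi : 'I_n -> R -> R) : Prop :=
  [/\ forall k, continuous (phi k),
      forall k (a b : R), `[a, b] `<=` `]-oo, tau0] ->
        absolutely_continuous_on a b (phi k),
      {ae (@completed_lebesgue_measure R), forall t : R, t <= tau0 ->
        forall k, is_derive t 1 (phi k)
          (G k t (\matrix_(m < n, j < N) phi m (beta m j t)))} &
      forall k (t : R), tau0 <= t -> phi k t = s k t].

End CauchyCoProblem.

(* Main.v *)
Require Import Defs.
From HB Require Import structures.
From mathcomp Require Import all_boot all_order all_algebra.
From mathcomp Require Import all_classical all_reals all_analysis.
From mathcomp Require Import measurable_realfun ring lra.

Set Implicit Arguments.
Unset Strict Implicit.
Unset Printing Implicit Defensive.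

Import Order.TTheory GRing.Theory Num.Theory.
Import numFieldNormedType.Exports.

Local Open Scope classical_set_scope.
Local Open Scope ring_scope.

(** Solutions of the Cauchy co problem are the fixed points of the backward
    integral operator [picard],
      (T phi)_k (t) = s_k (max t tau0) - int_t^tau0 G_k (z, phi (beta z)) dz,
    and this operator halves distances in a suitable weighted norm, so that
    Banach's argument gives existence and uniqueness together.

    The contraction. Let H = nN (h_1 + ... + h_n), let P t be the integral of H
    over [t, tau0] and let w = exp (4 P). Because the deviated arguments are
    advanced and w is nonincreasing, a bound |phi - psi| <= c w on [a, +oo[
    gives |G (z, phi (beta z)) - G (z, psi (beta z))| <= c w(z) H(z) for z in
    [a, tau0], and integrating w H = - w' / 4 backward gives
    |T phi - T psi| <= (c / 4) w. The half-lines [a, +oo[ are stable under the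
    advance, so the estimate holds on each of them separately, and no smallness
    of intervals and no gluing is involved. P is merely absolutely continuous,
    so w' is not available everywhere; [exponential_weight_increment]
    replaces the integration by a local convexity inequality, which is
    propagated to the whole interval, and loses a factor 2. Any two images of T
    differ by a continuous function that vanishes beyond tau0, hence is bounded
    on [a, +oo[, and w >= 1: this starts the geometric iteration of
    [weighted_contraction_fixpoint]. Measurability is the only regularity that
    has to survive the limit, since T turns measurable functions into
    continuous ones.

    The equivalence with the integral equation. If phi is a solution, then
    phi_k plus the backward integral of its right-hand side is absolutely
    continuous with zero derivative almost everywhere, hence constant
    ([absolutely_continuous_derive0]). Conversely the backward integral of a
    locally integrable function is absolutely continuous and has the opposite
    of the integrand as derivative almost everywhere. The latter is the
    Lebesgue differentiation theorem, which concerns Borel functions; the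
    problem is stated for the completed measure, so integrands are first
    replaced by Borel functions equal to them off a null set
    ([completed_integral_borel_version]). *)

(** * Lebesgue-measurable functions and Borel functions *)

Lemma borel_lebesgueR_measurable (R : realType) (A : set R) :
  measurable A -> measurable (A : set (lebesgueR R)).
Proof. exact: sub_caratheodory. Qed.

Lemma lebesgue_set_borel_part (R : realType) (A : set (lebesgueR R)) :
  measurable A -> exists2 B : set R, measurable B &
    exists2 M : set R, (@lebesgue_measure R).-negligible M & B `|` M = A.
Proof.
move=> mA; have calE := @completed_caratheodory_measurable R.
rewrite g_sigma_completed_algebra_genE in calE.
suff : completed_algebra_gen (@lebesgue_measure R) A by [].
by rewrite calE.
Qed.

(** A Lebesgue-measurable set is a Borel set up to a Borel null set, and the two
    measures are restrictions of the same outer measure. *)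
Lemma negligible_completedP (R : realType) (N : set R) :
  (@completed_lebesgue_measure R).-negligible N <->
  (@lebesgue_measure R).-negligible N.
Proof.
split=> [[A [mA A0 NA]]|[A [mA A0 NA]]]; last first.
  by exists A; split => //; exact: borel_lebesgueR_measurable.
have [B mB [M negM BMA]] := lebesgue_set_borel_part mA.
suff : (@lebesgue_measure R).-negligible A by exact: negligibleS.
rewrite -BMA; apply: negligibleU => //; exists B; split => //.
apply/eqP; rewrite eq_le measure_ge0 andbT -A0.
apply: (@le_measure _ _ _ (@completed_lebesgue_measure R) B A); rewrite ?inE//.
  exact: borel_lebesgueR_measurable.
by rewrite -BMA; left.
Qed.

(** Each superlevel set at a rational height is a Borel set up to a null set; the
    union N of these countably many null sets is null, and off N every
    superlevel set is a countable union of Borel ones. *)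
Lemma lebesgue_measurable_borel_version (R : realType) (D : set R) (g : R -> R) :
  measurable D -> measurable_fun (D : set (lebesgueR R)) (g : lebesgueR R -> R) ->
  exists N : set R, [/\ measurable N, lebesgue_measure N = 0%E &
    measurable_fun (D `\` N) g].
Proof.
move=> mD mg.
pose A (q : rat) : set R := D `&` g @^-1` `]ratr q, +oo[.
have mA q : measurable (A q : set (lebesgueR R)).
  apply: mg; first exact: borel_lebesgueR_measurable.
  exact: measurable_itv.
have /choice[B] : forall q, exists BN : set R * set R,
    [/\ measurable BN.1, measurable BN.2, lebesgue_measure BN.2 = 0%E,
        BN.1 `<=` A q & A q `<=` BN.1 `|` BN.2].
  move=> q; have [B mB [M [N [mN N0 MN]] <-]] := lebesgue_set_borel_part (mA q).
  exists (B, N); split; [exact: mB|exact: mN|exact: N0|exact: subsetUl|].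
  exact: setUS.
move=> BP; pose F n : set R := if unpickle n is Some q then (B q).2 else set0.
have mF n : measurable (F n).
  by rewrite /F; case: unpickle => // q; case: (BP q).
have F0 n : lebesgue_measure (F n) = 0%E.
  by rewrite /F; case: unpickle => [q|]; [case: (BP q) | rewrite measure0].
have [N [mN N0 FN]] : (@lebesgue_measure R).-negligible (\bigcup_n F n).
  apply: (@negligible_bigcup _ _ _ (@lebesgue_measure R) F) => k.
  by exists (F k); split; [exact: mF | exact: F0 | ].
have BN q : (B q).2 `<=` N.
  move=> x Bx; apply: FN; exists (pickle q); first exact: I.
  by rewrite /F pickleK.
have {}mN : measurable N by exact: mN.
exists N; split => //.
move=> mDN; apply: (measurability _ (RGenOInfty.measurableE R)) => //.
move=> _ [_ [r ->] <-].
rewrite (_ : _ `&` _ =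
  \bigcup_(q in [set q : rat | r < ratr q]) ((B q).1 `\` N)).
  rewrite bigcup_mkcond; apply: bigcupT_measurable_rat => q; case: ifPn => // _.
  by apply: measurableD => //; case: (BP q).
apply/seteqP; split => [x [[Dx Nx]]|x [q /= rq [Bx Nx]]].
  rewrite /= in_itv/= andbT => /rat_in_itvoo[q]; rewrite in_itv/= => /andP[rq qx].
  exists q => //; split => //.
  have [_ _ _ _] := BP q => /(_ x)[].
  - by split => //=; rewrite in_itv/= andbT.
  - by [].
  - by move=> /BN.
have [_ _ _ + _] := BP q => /(_ _ Bx)[Dx].
rewrite /= in_itv/= andbT => qx; split => //=.
by rewrite in_itv/= andbT (lt_trans rq).
Qed.

(** The Borel version of g is g itself, extended by zero from [a, b] \ N. The
    integrals agree because the Lebesgue measure on Borel sets is the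
    pushforward of the completed measure under the identity, which is
    measurable from the larger sigma-algebra to the smaller one. Vanishing to
    the right of b makes the primitive of f constant there, as the integral
    over [t, b] is when t > b. *)
Lemma completed_integral_borel_version (R : realType) (a b : R) (g : R -> R) :
  completed_lebesgue_measure.-integrable
    (`[a, b]%classic : set (lebesgueR R)) (EFin \o g) ->
  exists f : R -> R,
    [/\ forall x, b < x -> f x = 0,
        (@lebesgue_measure R).-integrable setT (EFin \o f),
        (@lebesgue_measure R).-negligible (`[a, b] `&` [set x | f x != g x]) &
        forall t, a <= t ->
        (\int[completed_lebesgue_measure]_(x in (`[t, b]%classic : set (lebesgueR R)))
           g x = \int[lebesgue_measure]_(x in `[t, b]) f x)%R].
Proof.
move=> intg.
have mg : measurable_fun (`[a, b]%classic : set (lebesgueR R)) (g : lebesgueR R -> R).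
  by apply/measurable_EFinP; exact: measurable_int intg.
have mab : measurable (`[a, b]%classic : set R) by exact: measurable_itv.
have [N [mN N0 mgN]] := lebesgue_measurable_borel_version mab mg.
have mabN : measurable (`[a, b] `\` N) by exact: measurableD.
pose f : R -> R := g \_ (`[a, b] `\` N).
have mf : measurable_fun setT f by apply/(measurable_restrictT _ _).1.
have mEf : measurable_fun (setT : set (measurableTypeR R)) (EFin \o f).
  exact/measurable_EFinP.
(* The identity, from the completed to the Borel sigma-algebra. *)
have mid : measurable_fun (setT : set (lebesgueR R))
    (idfun : lebesgueR R -> measurableTypeR R).
  by move=> _ Y mY; rewrite setTI; exact: borel_lebesgueR_measurable.
have intcf : completed_lebesgue_measure.-integrable
    (setT : set (lebesgueR R)) (EFin \o f).
  rewrite -restrict_EFin; apply/(integrable_mkcond _ _).1.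
    exact: borel_lebesgueR_measurable.
  apply: integrableS intg; [exact: borel_lebesgueR_measurable| |exact: subDsetl].
  exact: borel_lebesgueR_measurable.
have pushE (D : set (measurableTypeR R)) (F : measurableTypeR R -> \bar R) :
    (\int[pushforward completed_lebesgue_measure
       (idfun : lebesgueR R -> measurableTypeR R)]_(x in D) F x
     = \int[lebesgue_measure]_(x in D) F x)%E.
  exact: eq_measure_integral.
exists f; split.
- move=> x bx; rewrite /f patchE memNset// => -[+ _].
  by rewrite /= in_itv/= [x <= b]leNgt bx andbF.
- have /integrableP[_ fin] :=
    @integrable_pushforward _ _ _ _ R _ mid completed_lebesgue_measure setT
      _ mEf intcf measurableT.
  by apply/integrableP; split; [exact: mEf | rewrite -pushE].
- exists N; split; [exact: mN | exact: N0 |].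
  move=> x [abx /= /eqP fgx]; apply: contrapT => Nx.
  by apply: fgx; rewrite /f patchE mem_set.
- move=> t at_.
  have mtb : measurable (`[t, b]%classic : set R) by exact: measurable_itv.
  have tbab : `[t, b] `<=` `[a, b].
    by move=> x /=; rewrite !in_itv/= => /andP[tx ->]; rewrite (le_trans at_).
  rewrite /Rintegral -pushE (integral_pushforward mid mEf) //; last first.
    apply: integrableS intcf => //; exact: borel_lebesgueR_measurable.
  congr fine; apply: ae_eq_integral.
  + exact: borel_lebesgueR_measurable.
  + apply: (measurable_int completed_lebesgue_measure).
    apply: (@integrableS _ _ _ completed_lebesgue_measure
      (`[a, b]%classic : set (lebesgueR R)) (`[t, b]%classic : set (lebesgueR R))
      (EFin \o g)) => //; exact: borel_lebesgueR_measurable.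
  + apply: (measurable_int completed_lebesgue_measure).
    apply: (@integrableS _ _ _ completed_lebesgue_measure
      (setT : set (lebesgueR R)) (`[t, b]%classic : set (lebesgueR R))
      (EFin \o f)) => //; exact: borel_lebesgueR_measurable.
  + exists N; split; [exact: borel_lebesgueR_measurable|exact: N0|].
    move=> x /= /not_implyP[tbx gfx]; apply: contrapT => Nx; apply: gfx.
    by rewrite /f patchE mem_set//; split => //; exact: tbab.
Qed.

Lemma lebesgueR_measurable_itv (R : realType) (i : interval R) :
  measurable ([set` i] : set (lebesgueR R)).
Proof. by apply: borel_lebesgueR_measurable; exact: measurable_itv. Qed.

Lemma locally_lebesgue_integrableB (R : realType) (D : set R) (g1 g2 : R -> R) :
  locally_lebesgue_integrable D g1 -> locally_lebesgue_integrable D g2 ->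
  locally_lebesgue_integrable D (g1 \- g2).
Proof.
move=> int1 int2 a b abD; exact:
  (integrableB (lebesgueR_measurable_itv _) (int1 a b abD) (int2 a b abD)).
Qed.

Lemma locally_lebesgue_integrable_sum (R : realType) (n : nat) (D : set R) (c : R)
    (h : 'I_n -> R -> R) :
  (forall k, locally_lebesgue_integrable D (h k)) ->
  locally_lebesgue_integrable D (fun t => c * \sum_(k < n) h k t).
Proof.
move=> hint a b abD; have mab := lebesgueR_measurable_itv `[a, b].
apply: (@integrableZl _ _ _ completed_lebesgue_measure _ mab c
  (fun t => (\sum_(k < n) h k t)%:E)).
have := @integrable_sum _ _ _ completed_lebesgue_measure _ mab 'I_n
  (index_enum _) xpredT (fun k => EFin \o h k) (fun k _ => hint k a b abD).
by congr (_.-integrable _ _); apply/funext => t /=; rewrite sumEFin.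
Qed.

(** * Absolutely continuous functions with zero derivative almost everywhere *)

Lemma absolutely_continuousD (R : realType) (a b : R) (f g : R -> R) :
  absolutely_continuous_on a b f -> absolutely_continuous_on a b g ->
  absolutely_continuous_on a b (f \+ g).
Proof.
move=> fAC gAC e e0; have e2 : 0 < e / 2 by rewrite divr_gt0.
have [d1 d10 H1] := fAC _ e2; have [d2 d20 H2] := gAC _ e2.
exists (Num.min d1 d2); first by rewrite lt_min d10.
move=> m x y xy tI; rewrite lt_min => /andP[xy1 xy2].
have := H1 m x y xy tI xy1; have := H2 m x y xy tI xy2.
suff : \sum_(i < m) `|(f \+ g) (y i) - (f \+ g) (x i)| <=
  \sum_(i < m) `|f (y i) - f (x i)| + \sum_(i < m) `|g (y i) - g (x i)| by lra.
rewrite -big_split/=; apply: ler_sum => i _; rewrite opprD addrACA.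
exact: ler_normD.
Qed.

Lemma absolutely_continuous_continuous (R : realType) (f : R -> R) :
  (forall a b, absolutely_continuous_on a b f) -> continuous f.
Proof.
move=> fAC x; apply/cvgrPdist_lt => e e0.
have [d d0 fd] := fAC (x - 1) (x + 1) e e0.
have key u v : x - 1 <= u -> u <= v -> v <= x + 1 -> v - u < d ->
    `|f v - f u| < e.
  move=> xu uv vx vud.
  have := fd 1%N (fun=> u) (fun=> v); rewrite !big_ord1; apply=> //.
  by move=> i j _ _ _; rewrite !ord1.
near=> y.
have yx : `|x - y| < Num.min 1 d.
  by near: y; apply: cvgr_dist_lt => //; rewrite lt_min ltr01.
move: yx; rewrite lt_min => /andP[]; rewrite ltr_norml => /andP[? ?].
rewrite ltr_norml => /andP[? ?].
have [xy|yx] := leP x y; first by rewrite distrC; apply: key; lra.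
by apply: key; lra.
Unshelve. all: by end_near. Qed.

(** A substitute for compactness of [a, b] in the style of Cousin's lemma: what
    holds for all small intervals around each point, and passes to unions of
    adjacent intervals, holds for [a, b]. The supremum of the z such that P a z
    holds can neither fail to be reached nor be smaller than b. *)
Lemma interval_gauge_induction (R : realType) (a b : R) (P : R -> R -> Prop) :
  a <= b ->
  (forall x y z, a <= x -> x <= y -> y <= z -> z <= b ->
     P x y -> P y z -> P x z) ->
  (forall t, a <= t -> t <= b -> exists2 d, 0 < d &
     forall x y, a <= x -> x <= t -> t <= y -> y <= b ->
       t - d < x -> y < t + d -> P x y) ->
  P a b.
Proof.
move=> ab Padd Ploc.
have Paa : P a a.
  by have [d d0] := Ploc a (lexx _) ab; apply=> //; lra.
pose S := [set z | [/\ a <= z, z <= b & P a z]].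
have Sa : S a by [].
have hsS : has_sup S by split; [exists a | exists b => z []].
set c := sup S.
have ac : a <= c by apply: sup_upper_bound.
have cb : c <= b by apply: ge_sup; [exists a | move=> z []].
have [d d0 Pd] := Ploc c ac cb.
have [z [az zb Pz] cz] := sup_adherent d0 hsS.
have zc : z <= c by apply: sup_upper_bound.
have Pay y : c <= y -> y <= b -> y < c + d -> P a y.
  by move=> cy yb ycd; apply: (Padd a z y) => //; [lra | apply: Pd].
have [cb'|bc] := ltP c b; last first.
  have <- : c = b by lra.
  by apply: Pay; lra.
have [cdb|bcd] := ltP (c + d / 2) b; last by apply: Pay; lra.
have : c + d / 2 <= c.
  apply: sup_upper_bound => //; rewrite /S/=; split; [lra | lra |].
  by apply: Pay; lra.
lra.
Qed.

Lemma negligible_open_cover (R : realType) (N : set R) (e : R) :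
  (@lebesgue_measure R).-negligible N -> 0 < e ->
  exists U : set R, [/\ open U, N `<=` U & (lebesgue_measure U < e%:E)%E].
Proof.
move=> [A [mA A0 NA]] e0.
have [|U [oU AU UA]] := @lebesgue_regularity_outer R A e mA _ e0.
  by rewrite [ltLHS]A0 ltry.
exists U; split => //; first exact: subset_trans AU.
apply: le_lt_trans UA; rewrite -{1}(setDUK AU).
apply: le_trans (@measureU2 _ _ _ (@lebesgue_measure R) _ _ mA _) _.
  by apply: measurableD => //; exact: open_measurable.
by rewrite [X in (X + _ <= _)%E]A0 add0e.
Qed.

Lemma sum_length_le_measure (R : realType) (m : nat) (x y : 'I_m -> R) (U : set R) :
  measurable U -> (forall i, x i <= y i) ->
  trivIset [set: 'I_m] (fun i => `]x i, y i[%classic) ->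
  (forall i, `]x i, y i[ `<=` U) ->
  ((\sum_(i < m) (y i - x i))%:E <= lebesgue_measure U)%E.
Proof.
move=> mU xy tI IU; rewrite -sumEFin.
rewrite (eq_bigr (fun i => lebesgue_measure `]x i, y i[%classic)); last first.
  move=> i _; rewrite lebesgue_measure_itv/= lte_fin; case: ltP => // yx.
  have -> : x i = y i by apply/eqP; rewrite eq_le xy yx.
  by rewrite subrr.
rewrite -(@measure_bigsetU_ord _ _ _ (@lebesgue_measure R))//.
apply: le_measure; rewrite ?inE//.
  by apply: bigsetU_measurable.
by apply: (big_ind (fun A => A `<=` U)) => // A B AU BU z []; [exact: AU|exact: BU].
Qed.

Lemma is_derive_slope (R : realType) (f : R -> R) (t l e : R) :
  is_derive t 1 f l -> 0 < e ->
  exists2 d, 0 < d & forall y, `|y - t| < d ->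
    `|f y - f t - l * (y - t)| <= e * `|y - t|.
Proof.
move=> [dft <-] e0.
have /cvgrPdist_le /(_ _ e0) : h^-1 *: ((f \o shift t) (h *: 1) - f t)
    @[h --> 0^'] --> 'D_1 f t by exact: dft.
move=> [d /= d0 Hd]; exists d => // y ytd.
have [->|yt] := eqVneq y t; first by rewrite !subrr mulr0 subr0 normr0 mulr0.
have yt0 : y - t != 0 by rewrite subr_eq0.
have := Hd (y - t); rewrite /= sub0r normrN => /(_ ytd yt0).
rewrite /= [_%:A]mulr1 subrK /GRing.scale/= => H.
rewrite (_ : f y - f t - _ =
    - (('D_1 f t - (y - t)^-1 * (f y - f t)) * (y - t))).
  by rewrite normrN normrM ler_wpM2r.
by field.
Qed.

(** The intervals of the family are meant to carry the oscillation of f at the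
    points of a null set with open neighbourhood U, where nothing is known of
    the derivative; elsewhere the slope of f is at most e. *)
Definition covered_oscillation (R : realType) (U : set R) (e : R) (f : R -> R)
    (x y : R) : Prop :=
  exists (m : nat) (u v : 'I_m -> R),
    [/\ forall i, [/\ x <= u i, u i <= v i & v i <= y],
        trivIset [set: 'I_m] (fun i => `]u i, v i[%classic),
        forall i, `]u i, v i[ `<=` U &
        `|f y - f x| <= e * (y - x) + \sum_(i < m) `|f (v i) - f (u i)|].

Lemma covered_oscillation_trans (R : realType) (U : set R) (e : R) (f : R -> R)
    (x y z : R) : x <= y -> y <= z ->
  covered_oscillation U e f x y -> covered_oscillation U e f y z ->
  covered_oscillation U e f x z.
Proof.
move=> xy yz [m1 [u1 [v1 [I1 T1 U1 E1]]]] [m2 [u2 [v2 [I2 T2 U2 E2]]]].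
pose glue (w1 : 'I_m1 -> R) (w2 : 'I_m2 -> R) (i : 'I_(m1 + m2)) :=
  match fintype.split i with inl j => w1 j | inr j => w2 j end.
exists (m1 + m2)%N, (glue u1 u2), (glue v1 v2); split.
- move=> i; rewrite /glue; case: (fintype.split i) => j.
    by have [? ? ?] := I1 j; split => //; lra.
  by have [? ? ?] := I2 j; split => //; lra.
- move=> i1 i2 _ _; rewrite -{3}(splitK i1) -{3}(splitK i2) /glue.
  case: (fintype.split i1) (fintype.split i2) => j1 [] j2 [r /= []] /=; rewrite !in_itv/=.
  + by move=> r1 r2; congr lshift; apply: T1 => //; exists r; rewrite /= !in_itv.
  + move=> /andP[? ?] /andP[? ?]; exfalso.
    by have [? ? ?] := I1 j1; have [? ? ?] := I2 j2; lra.
  + move=> /andP[? ?] /andP[? ?]; exfalso.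
    by have [? ? ?] := I2 j1; have [? ? ?] := I1 j2; lra.
  + by move=> r1 r2; congr rshift; apply: T2 => //; exists r; rewrite /= !in_itv.
- by move=> i; rewrite /glue; case: (fintype.split i) => j; [exact: U1 | exact: U2].
- rewrite big_split_ord/= (eq_bigr (fun i => `|f (v1 i) - f (u1 i)|)).
    rewrite [X in _ + (_ + X)](eq_bigr (fun i => `|f (v2 i) - f (u2 i)|)).
      rewrite (_ : f z - f x = (f y - f x) + (f z - f y)); last by ring.
      by apply: le_trans (ler_normD _ _) _; lra.
    by move=> i _; rewrite /glue (unsplitK (inr i : 'I_m1 + 'I_m2)).
  by move=> i _; rewrite /glue (unsplitK (inl i : 'I_m1 + 'I_m2)).
Qed.

(** Cover the null set of bad points by an open set U of measure less than the
    modulus d of absolute continuity for e. Around a good point the oscillation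
    of f is at most e times the length; around a bad point a whole interval
    lies in U. By [interval_gauge_induction] these local bounds add up on
    [a, b], and the contribution of the intervals in U is less than e by
    absolute continuity, their total length being less than d. *)
Lemma absolutely_continuous_derive0 (R : realType) (a b : R) (f : R -> R) :
  a <= b -> absolutely_continuous_on a b f ->
  (@lebesgue_measure R).-negligible
    [set t | [/\ a < t, t < b & ~ is_derive t 1 f 0]] ->
  f a = f b.
Proof.
move=> ab fAC negN.
suff small e : 0 < e -> `|f b - f a| <= e * (b - a) + e.
  apply/esym/eqP; rewrite -subr_eq0 -normr_le0; apply/ler_addgt0Pr => e e0.
  have ba1 : 0 < b - a + 1 by lra.
  rewrite add0r; have := small (e / (b - a + 1)) (divr_gt0 e0 ba1).
  rewrite -{2}[_ / _]mulr1 -mulrDr divfK//; exact: lt0r_neq0.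
move=> e0; have [d d0 fd] := fAC e e0.
set N := [set t | _] in negN.
have neg1 (c : R) : (@lebesgue_measure R).-negligible [set c].
  by exists [set c]; split; [exact: measurable_set1 | exact: lebesgue_measure_set1 | by []].
(* The end points count as bad points, so that good points are interior. *)
have [U [oU NU Ud]] := negligible_open_cover
  (negligibleU negN (negligibleU (neg1 a) (neg1 b))) d0.
suff [m [u [v [uv tuv uvU fba]]]] : covered_oscillation U e f a b.
  apply: le_trans fba _; rewrite lerD2l ltW//; apply: fd => //.
  rewrite -lte_fin; apply: le_lt_trans Ud.
  by apply: sum_length_le_measure => // [|i]; [exact: open_measurable | case: (uv i)].
apply: interval_gauge_induction => //.
  move=> x y z _ xy yz _; exact: covered_oscillation_trans.
move=> t at_ tb; have [Ut|nUt] := pselect (U t).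
  have [r /= r0 rU] : nbhs t U by apply: open_nbhs_nbhs.
  exists r => // x y ax xt ty yb rx yr.
  exists 1%N, (fun=> x), (fun=> y); split => //.
  - by move=> _; split => //; apply: le_trans ty.
  - by move=> i j _ _ _; rewrite !ord1.
  - move=> _ z; rewrite /= in_itv/= => /andP[xz zy]; apply: rU.
    by rewrite /ball_/= ltr_norml; apply/andP; split; lra.
  - rewrite big_ord1; have : 0 <= e * (y - x) by apply: mulr_ge0; lra.
    lra.
have a_t : a < t.
  by rewrite lt_neqAle at_ andbT; apply/eqP => at'; apply/nUt/NU; right; left.
have t_b : t < b.
  by rewrite lt_neqAle tb andbT; apply/eqP => tb'; apply/nUt/NU; right; right.
have /is_derive_slope /(_ e0) [r r0 Hr] : is_derive t 1 f 0.
  by apply: contrapT => Nd; apply/nUt/NU; left.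
exists r => // x y ax xt ty yb rx yr.
exists 0%N, (fun=> 0), (fun=> 0); split => [[]//|[]//|[]//|].
rewrite big_ord0 addr0.
have tx0 : 0 <= t - x by lra.
have yt0 : 0 <= y - t by lra.
have Hx : `|f t - f x| <= e * (t - x).
  have := Hr x; rewrite mul0r subr0 (distrC (f x)) (distrC x) (ger0_norm tx0).
  by apply; lra.
have Hy : `|f y - f t| <= e * (y - t).
  by have := Hr y; rewrite mul0r subr0 (ger0_norm yt0); apply; lra.
rewrite (_ : f y - f x = (f y - f t) + (f t - f x)); last by ring.
by apply: le_trans (ler_normD _ _) _; lra.
Qed.

(** * Primitives of integrable Borel functions *)

Lemma primitive_increment_le (R : realType) (f : R -> R) (x y : R) :
  (@lebesgue_measure R).-integrable setT (EFin \o f) -> x <= y ->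
  `|\int[lebesgue_measure]_(t in `]-oo, y]) f t
    - \int[lebesgue_measure]_(t in `]-oo, x]) f t|
  <= \int[lebesgue_measure]_(t in `]x, y[) `|f t|.
Proof.
move=> intf xy.
have intS (i : interval R) : (@lebesgue_measure R).-integrable [set` i] (EFin \o f).
  by apply: integrableS intf => //; exact: measurable_itv.
rewrite (Rintegral_itvB (intS _)) ?bnd_simp//.
rewrite -(Rintegral_itv_bndo_bndc (intS _)).
by apply: le_normr_Rintegral => //; exact: measurable_itv.
Qed.

(** The increments over disjoint intervals are bounded by the integral of |f|
    over their union, which is small with the measure of the union. *)
Lemma primitive_absolutely_continuous (R : realType) (f : R -> R) (a b : R) :
  (@lebesgue_measure R).-integrable setT (EFin \o f) ->
  absolutely_continuous_on a b
    (fun x => \int[lebesgue_measure]_(t in `]-oo, x]) f t).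
Proof.
move=> intf e e0.
have [d [d0 Hd]] := integral_normr_continuous intf e0.
exists d => // m x y xy tI sd.
pose I (i : 'I_m) : set R := `]x i, y i[%classic.
pose D := \big[setU/set0]_(i < m) I i.
have mI i : measurable (I i) by exact: measurable_itv.
have mD : measurable D by exact: bigsetU_measurable.
have muI i : lebesgue_measure (I i) = (y i - x i)%:E.
  have [_ xyi _] := xy i; rewrite lebesgue_measure_itv/= lte_fin.
  case: ltP => // yx; have -> : x i = y i by apply/eqP; rewrite eq_le xyi yx.
  by rewrite subrr.
have mDd : (lebesgue_measure D < d%:E)%E.
  rewrite (@measure_bigsetU_ord _ _ _ (@lebesgue_measure R))//.
  by rewrite (eq_bigr _ (fun i _ => muI i)) sumEFin lte_fin.
have intn (A : set R) : measurable A ->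
    (@lebesgue_measure R).-integrable A (fun t => `|f t|%:E).
  move=> mA; have := integrable_abse intf; apply: integrableS => //.
apply: le_lt_trans (Hd D mD mDd).
apply: (@le_trans _ _ (\sum_(i < m) \int[lebesgue_measure]_(t in I i) `|f t|)).
  apply: ler_sum => i _; have [_ xyi _] := xy i.
  exact: primitive_increment_le.
rewrite -lee_fin -sumEFin /Rintegral fineK; last first.
  by apply: integrable_fin_num; [exact: mD | exact: (intn D mD)].
rewrite integral_bigsetU_EFin//=; last 3 first.
- exact: index_enum_uniq.
- by apply: sub_trivIset tI.
- by have := measurable_int _ (intn _ mD).
apply: lee_sum => i _; rewrite fineK//.
by apply: integrable_fin_num; [exact: mI | exact: (intn (I i) (mI i))].
Qed.

Lemma primitive_ae_derive (R : realType) (f : R -> R) :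
  (@lebesgue_measure R).-integrable setT (EFin \o f) ->
  (@lebesgue_measure R).-negligible [set t : R |
    ~ is_derive t 1 (fun x => \int[lebesgue_measure]_(u in `]-oo, x]) f u) (f t)].
Proof.
move=> intf.
have lf : locally_integrable setT f by exact: open_integrable_locally openT intf.
have intS (y : R) : (@lebesgue_measure R).-integrable `]-oo, y] (EFin \o f).
  by apply: integrableS intf => //; exact: measurable_itv.
apply: negligibleS (FTC1Ny intS lf) => t /= + [dF F't]; apply.
by split; [exact: dF | rewrite -F't derive1E].
Qed.

(** * Tail integrals with respect to the completed Lebesgue measure *)

Definition tail_integral (R : realType) (tau0 : R) (g : R -> R) (t : R) : R :=
  \int[completed_lebesgue_measure]_(x in (`[t, tau0]%classic : set (lebesgueR R)))
    g x.

Lemma tail_integral_ge (R : realType) (tau0 t : R) (g : R -> R) :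
  tau0 <= t -> tail_integral tau0 g t = 0.
Proof.
rewrite le_eqVlt => /predU1P[<-|t0]; last first.
  by rewrite /tail_integral set_itv_ge ?Rintegral_set0// bnd_simp -ltNge.
rewrite /tail_integral /Rintegral set_itv1.
have m1 := borel_lebesgueR_measurable (measurable_set1 tau0).
have f1 : measurable_fun ([set tau0] : set (lebesgueR R)) (EFin \o g).
  exact: measurable_fun_set1.
by rewrite (@null_set_integral _ _ _ completed_lebesgue_measure _ _ m1 f1
  (lebesgue_measure_set1 tau0)).
Qed.

Lemma locally_integrable_tail (R : realType) (tau0 a b : R) (g : R -> R) :
  locally_lebesgue_integrable `]-oo, tau0] g -> b <= tau0 ->
  completed_lebesgue_measure.-integrable
    (`[a, b]%classic : set (lebesgueR R)) (EFin \o g).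
Proof.
move=> gint b0; apply: gint => x; rewrite /= !in_itv/= => /andP[_ xb].
exact: le_trans b0.
Qed.

(** On every half-line [a, +oo[ the tail integral is a constant minus the
    primitive of one integrable Borel function, which brings the
    differentiation theorem within reach. *)
Lemma tail_integral_primitive (R : realType) (tau0 a : R) (g : R -> R) :
  locally_lebesgue_integrable `]-oo, tau0] g ->
  exists f : R -> R,
    [/\ (@lebesgue_measure R).-integrable setT (EFin \o f),
        (@lebesgue_measure R).-negligible
          (`[a, tau0] `&` [set x | f x != g x]) &
        forall t, a <= t -> tail_integral tau0 g t =
          \int[lebesgue_measure]_(x in `]-oo, tau0]) f x
          - \int[lebesgue_measure]_(x in `]-oo, t]) f x].
Proof.
move=> gint; have gab := locally_integrable_tail a gint (lexx tau0).
have [f [f0 intf fg fE]] := completed_integral_borel_version gab.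
have intS (i : interval R) : (@lebesgue_measure R).-integrable [set` i] (EFin \o f).
  by apply: integrableS intf => //; exact: measurable_itv.
exists f; split => // t at_.
have [tb|bt] := leP t tau0.
  rewrite (Rintegral_itvB (intS _)) ?bnd_simp//.
  by rewrite (Rintegral_itv_obnd_cbnd (intS _)); exact: fE.
rewrite tail_integral_ge ?ltW// -opprB (Rintegral_itvB (intS _)) ?bnd_simp ?ltW//.
rewrite (@eq_Rintegral _ _ _ _ _ (cst 0)); last first.
  by move=> x; rewrite inE/= in_itv/= => /andP[bx _]; exact: f0.
by rewrite Rintegral_cst ?mul0r ?oppr0//; exact: measurable_itv.
Qed.

Lemma tail_integral_absolutely_continuous (R : realType) (tau0 a b : R) (g : R -> R) :
  locally_lebesgue_integrable `]-oo, tau0] g ->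
  absolutely_continuous_on a b (tail_integral tau0 g).
Proof.
move=> gint e e0.
have [f [intf _ fE]] := tail_integral_primitive a gint.
have [d d0 Hd] := primitive_absolutely_continuous a b intf e0.
exists d => // m x y xy tI /(Hd _ _ _ xy tI); apply: le_lt_trans.
apply: ler_sum => i _; have [ax xyi _] := xy i.
rewrite !fE ?(le_trans ax)// [X in `|X|](_ : _ =
  \int[lebesgue_measure]_(t in `]-oo, x i]) f t -
  \int[lebesgue_measure]_(t in `]-oo, y i]) f t); last by ring.
by rewrite distrC.
Qed.

Lemma tail_integral_continuous (R : realType) (tau0 : R) (g : R -> R) :
  locally_lebesgue_integrable `]-oo, tau0] g -> continuous (tail_integral tau0 g).
Proof.
move=> gint; apply: absolutely_continuous_continuous => a b.
exact: tail_integral_absolutely_continuous.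
Qed.

(** The Borel version of g depends on the left end a, so the exceptional set is
    first bounded on each ]tau0 - n, tau0[. *)
Lemma tail_integral_ae_derive (R : realType) (tau0 : R) (g : R -> R) :
  locally_lebesgue_integrable `]-oo, tau0] g ->
  (@lebesgue_measure R).-negligible [set t : R |
    t < tau0 /\ ~ is_derive t 1 (tail_integral tau0 g) (- g t)].
Proof.
move=> gint.
pose B (n : nat) : set R := [set t : R | [/\ tau0 - n%:R < t, t < tau0 &
  ~ is_derive t 1 (tail_integral tau0 g) (- g t)]].
suff negB n : (@lebesgue_measure R).-negligible (B n).
  apply: negligibleS (@negligible_bigcup _ _ _ (@lebesgue_measure R) B negB).
  move=> t /= [t0 Nt]; exists (Num.truncn (tau0 - t)).+1 => //; split => //.
  have := truncnS_gt (tau0 - t); lra.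
set a := tau0 - n%:R.
have [f [intf fg fE]] := tail_integral_primitive a gint.
apply: negligibleS (negligibleU fg (primitive_ae_derive intf)).
move=> t /= [at_ t0 Nt].
have [ft|ft] := eqVneq (f t) (g t); last first.
  by left; split; [rewrite in_itv/= (ltW at_) (ltW t0) | ].
right=> dF; apply: Nt; rewrite -ft.
set F := fun x => _ in dF.
apply: (@near_eq_is_derive _ _ _ (cst (F tau0) - F)).
  near=> x; rewrite fE//; apply/ltW.
  by near: x; exact: lt_nbhsr.
by rewrite -[- f t]add0r; apply: is_deriveB.
Unshelve. all: by end_near. Qed.

Lemma tail_integral_increment (R : realType) (tau0 x y : R) (g : R -> R) :
  locally_lebesgue_integrable `]-oo, tau0] g -> x <= y -> y <= tau0 ->
  tail_integral tau0 g x - tail_integral tau0 g y =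
  \int[completed_lebesgue_measure]_(t in (`[x, y[%classic : set (lebesgueR R))) g t.
Proof.
move=> gint xy y0.
have mitv := @lebesgueR_measurable_itv R.
have xyU : `[x, tau0]%classic = `[x, y[%classic `|` `[y, tau0]%classic.
  by rewrite -itv_bndbnd_setU ?bnd_simp.
have intx := locally_integrable_tail x gint (lexx tau0).
rewrite xyU in intx.
rewrite /tail_integral xyU (Rintegral_setU (mitv _) (mitv _) intx) ?addrK//.
apply/disj_setPS => z [] /=; rewrite !in_itv/= => /andP[_ zy] /andP[yz _].
by have := lt_le_trans zy yz; rewrite ltxx.
Qed.

(** Only a pointwise bound of g by a constant multiple of h enters here, so that
    no product of h with a weight ever has to be shown integrable. *)
Lemma tail_integral_increment_le (R : realType) (tau0 x y K : R) (g h : R -> R) :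
  locally_lebesgue_integrable `]-oo, tau0] g ->
  locally_lebesgue_integrable `]-oo, tau0] h ->
  x <= y -> y <= tau0 ->
  (forall t, x <= t -> t < y -> `|g t| <= K * h t) ->
  `|tail_integral tau0 g x - tail_integral tau0 g y| <=
  K * (tail_integral tau0 h x - tail_integral tau0 h y).
Proof.
move=> gint hint xy y0 gh.
have mxy := lebesgueR_measurable_itv `[x, y[.
have intxy f : locally_lebesgue_integrable `]-oo, tau0] f ->
    completed_lebesgue_measure.-integrable
      (`[x, y[%classic : set (lebesgueR R)) (EFin \o f).
  move=> fint; have := locally_integrable_tail x fint y0.
  apply: integrableS => //; try exact: lebesgueR_measurable_itv.
  by move=> t; rewrite /= !in_itv/= => /andP[-> /ltW].
rewrite !tail_integral_increment// -(RintegralZl K mxy (intxy _ hint)).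
apply: le_trans (le_normr_Rintegral mxy (intxy _ gint)) _.
apply: le_Rintegral => //.
- exact: (integrable_abse (intxy _ gint)).
- exact: (integrableZl mxy K (intxy _ hint)).
- by move=> t; rewrite /= in_itv/= => /andP[xt ty]; apply: gh.
Qed.

Lemma tail_integralB (R : realType) (tau0 t : R) (g1 g2 : R -> R) :
  locally_lebesgue_integrable `]-oo, tau0] g1 ->
  locally_lebesgue_integrable `]-oo, tau0] g2 ->
  tail_integral tau0 (g1 \- g2) t =
  tail_integral tau0 g1 t - tail_integral tau0 g2 t.
Proof.
move=> int1 int2; exact: (RintegralB (lebesgueR_measurable_itv _)
  (locally_integrable_tail t int1 (lexx tau0))
  (locally_integrable_tail t int2 (lexx tau0))).
Qed.

Lemma tail_integral_nonincreasing (R : realType) (tau0 x y : R) (h : R -> R) :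
  locally_lebesgue_integrable `]-oo, tau0] h ->
  (forall t, t <= tau0 -> 0 <= h t) ->
  x <= y -> tail_integral tau0 h y <= tail_integral tau0 h x.
Proof.
move=> hint h0 xy; have [y0|/ltW y0] := leP y tau0.
  rewrite -subr_ge0 tail_integral_increment//; apply: Rintegral_ge0 => t /=.
  by rewrite in_itv/= => /andP[_ ty]; apply/h0/ltW/(lt_le_trans ty).
rewrite (tail_integral_ge _ y0); apply: Rintegral_ge0 => t /=.
by rewrite in_itv/= => /andP[_]; exact: h0.
Qed.

(** * The exponential weight *)

(** The exponential weight of Bielecki's norm; the factor 4 is what makes the
    contraction constant 1/2 below. *)
Definition bielecki_weight (R : realType) (tau0 : R) (h : R -> R) (t : R) : R :=
  expR (4 * tail_integral tau0 h t).

(** Morally J is the integral over [t, b] of a function bounded by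
    - c w P' with w = exp (4 P), and the claim is the integral of - w P' in
    closed form, with 1/2 in place of 1/4. On an interval short enough for w to
    vary by a factor at most 2, convexity of exp gives
    w x - w y >= 4 w y (P x - P y) >= 2 w x (P x - P y), which is the claim
    there; and the claim is additive in the interval. *)
Lemma exponential_weight_increment (R : realType) (J P : R -> R) (a b c : R) :
  a <= b -> 0 <= c -> continuous P -> (forall x y, x <= y -> P y <= P x) ->
  (forall x y, a <= x -> x <= y -> y <= b ->
     `|J x - J y| <= c * expR (4 * P x) * (P x - P y)) ->
  `|J a - J b| <= c / 2 * (expR (4 * P a) - expR (4 * P b)).
Proof.
move=> ab c0 Pc Pmono JP.
pose w x := expR (4 * P x); rewrite -/(w a) -/(w b).
have w0 z : 0 < w z by exact: expR_gt0.
have wc : continuous w.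
  move=> z; apply: (@continuous_comp _ _ _ (fun u => 4 * P u) expR).
    by apply: continuousM; [exact: cst_continuous | exact: Pc].
  exact: continuous_expR.
have expxy x y : w y * (1 + 4 * (P x - P y)) <= w x.
  rewrite (_ : w x = w y * expR (4 * (P x - P y))).
    by rewrite ler_pM2l// expR_ge1Dx.
  by rewrite /w -expRD; congr expR; ring.
have JPw x y : a <= x -> x <= y -> y <= b ->
  `|J x - J y| <= c * w x * (P x - P y) by exact: JP.
(* These four properties of w are all that the rest of the argument uses. *)
move: (w) w0 wc expxy JPw => {}w w0 wc expxy JPw {JP}.
apply: (@interval_gauge_induction _ a b (fun x y =>
  `|J x - J y| <= c / 2 * (w x - w y))) => //.
  move=> x y z _ _ _ _ Hxy Hyz; rewrite -(subrKA (J y)).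
  by apply: le_trans (ler_normD _ _) _; lra.
move=> s as_ sb; have ws3 : 0 < w s / 3 by rewrite divr_gt0.
have /cvgrPdist_lt /(_ _ ws3) [d /= d0 wd] := wc s.
exists d => // x y ax xs sy yb dx yd.
have xy : x <= y by exact: le_trans sy.
have wx2y : w x <= 2 * w y.
  have : `|w s - w x| < w s / 3 by apply: wd; rewrite /ball_/= ger0_norm; lra.
  have : `|w s - w y| < w s / 3 by apply: wd; rewrite /ball_/= ler0_norm; lra.
  by rewrite !ltr_norml => /andP[? ?] /andP[? ?]; lra.
have Pxy : 0 <= P x - P y by rewrite subr_ge0; exact: Pmono.
apply: le_trans (JPw x y ax xy yb) _.
rewrite -!mulrA; apply: ler_wpM2l => //.
have : w x * (P x - P y) <= 2 * w y * (P x - P y) by exact: ler_wpM2r.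
have := expxy x y.
lra.
Qed.

Lemma tail_integral_weight_le (R : realType) (tau0 a c : R) (g h : R -> R) :
  locally_lebesgue_integrable `]-oo, tau0] g ->
  locally_lebesgue_integrable `]-oo, tau0] h ->
  (forall t, t <= tau0 -> 0 <= h t) -> 0 <= c ->
  (forall t, a <= t -> t <= tau0 ->
     `|g t| <= c * bielecki_weight tau0 h t * h t) ->
  forall t, a <= t ->
    `|tail_integral tau0 g t| <= c / 2 * bielecki_weight tau0 h t.
Proof.
move=> gint hint h0 c0 gh t at_.
have [t0|/ltW t0] := leP t tau0; last first.
  rewrite (tail_integral_ge _ t0) normr0; apply: mulr_ge0; last exact: expR_ge0.
  exact: divr_ge0.
have mono x y : x <= y -> tail_integral tau0 h y <= tail_integral tau0 h x.
  exact: tail_integral_nonincreasing.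
have := @exponential_weight_increment R (tail_integral tau0 g)
  (tail_integral tau0 h) t tau0 c t0 c0 (tail_integral_continuous hint) mono.
rewrite [X in `|_ - X|](tail_integral_ge _ (lexx tau0)) subr0.
move=> /(_ _) /le_trans; apply.
  move=> x y tx xy y0; apply: tail_integral_increment_le; [by []..|].
  move=> z xz zy; have z0 := ltW (lt_le_trans zy y0).
  apply: le_trans (gh z (le_trans at_ (le_trans tx xz)) z0) _.
  apply: ler_wpM2r; first exact: h0.
  apply: ler_wpM2l; first by [].
  by rewrite ler_expR ler_wpM2l//; exact: mono.
apply: ler_wpM2l; first exact: divr_ge0.
by rewrite lerBlDr lerDl; exact: expR_ge0.
Qed.

Lemma bielecki_weight_ge1 (R : realType) (tau0 t : R) (h : R -> R) :
  (forall t, t <= tau0 -> 0 <= h t) -> 1 <= bielecki_weight tau0 h t.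
Proof.
move=> h0; rewrite -expR0 ler_expR mulr_ge0//; apply: Rintegral_ge0 => z /=.
by rewrite in_itv/= => /andP[_]; exact: h0.
Qed.

(** * Fixed points of weighted contractions *)

Lemma geometric_bound_le0 (R : realType) (x K : R) :
  (forall i, x <= K / 2 ^+ i) -> x <= 0.
Proof.
move=> xK; rewrite leNgt; apply/negP => x0.
set i := (Num.truncn (K / x)).+1.
have Ki : K / x < i%:R by exact: truncnS_gt.
have i2 : i%:R <= 2 ^+ i :> R by rewrite -natrX ler_nat ltnW// ltn_expl.
have p0 : 0 < 2 ^+ i :> R by rewrite exprn_gt0.
have := xK i; rewrite ler_pdivlMr//; apply/negP; rewrite -ltNge.
by rewrite mulrC -ltr_pdivrMr//; exact: lt_le_trans i2.
Qed.

(** The intervals [u i - 2 K / 2^i, u i + 2 K / 2^i] are nested, so the limit is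
    the supremum of their left ends; the rate of convergence comes for free. *)
Lemma geometric_steps_limit (R : realType) (u : nat -> R) (K : R) :
  (forall i, `|u i.+1 - u i| <= K / 2 ^+ i) ->
  exists2 l, u i @[i --> \oo] --> l & forall i, `|l - u i| <= 2 * K / 2 ^+ i.
Proof.
move=> uK; pose lo i := u i - 2 * K / 2 ^+ i; pose hi i := u i + 2 * K / 2 ^+ i.
have K0 : 0 <= K.
  by apply: le_trans (normr_ge0 (u 1%N - u 0%N)) _; rewrite -[K]divr1; exact: (uK 0%N).
have e0 i : 0 <= K / 2 ^+ i by rewrite divr_ge0// exprn_ge0.
have eS i : 2 * K / 2 ^+ i.+1 = K / 2 ^+ i.
  by rewrite exprS -mulf_div divff ?mul1r// pnatr_eq0.
have loS i : lo i <= lo i.+1.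
  rewrite /lo eS; have := uK i; rewrite ler_norml => /andP[? ?]; lra.
have hiS i : hi i.+1 <= hi i.
  rewrite /hi eS; have := uK i; rewrite ler_norml => /andP[? ?]; lra.
have lohi i : lo i <= hi i by rewrite /lo /hi; have := e0 i; lra.
have lo_nd : {homo lo : i j / (i <= j)%N >-> i <= j}.
  by apply: homo_leq => //; exact: le_trans.
have hi_ni : {homo hi : i j / (i <= j)%N >-> j <= i}.
  by apply: homo_leq => // x y z xy yz; exact: le_trans yz xy.
have lo_le_hi i j : lo i <= hi j.
  apply: le_trans (lo_nd _ _ (leq_maxl i j)) _.
  by apply: le_trans (hi_ni _ _ (leq_maxr i j)); exact: lohi.
have hsl : has_sup (range lo).
  by split; [exists (lo 0%N), 0%N | exists (hi 0%N) => _ [i _ <-]].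
pose l := sup (range lo).
have lol i : lo i <= l by apply: sup_upper_bound => //; exists i.
have lhi i : l <= hi i.
  by apply: ge_sup; [exists (lo 0%N), 0%N | move=> _ [j _ <-]].
have lu i : `|l - u i| <= 2 * K / 2 ^+ i.
  by have := lol i; have := lhi i; rewrite /lo /hi ler_norml => ? ?; lra.
exists l => //; apply/cvgrPdist_le => e e_gt0.
have [i0 Hi0] : exists i0, 2 * K / 2 ^+ i0 <= e.
  apply: contrapT => /forallNP He.
  suff : e <= 0 by rewrite leNgt e_gt0.
  apply: (@geometric_bound_le0 _ e (2 * K)) => i.
  by rewrite leNgt; apply/negP => /ltW /He.
exists i0 => // i /= i0i; apply: le_trans (lu i) _; apply: le_trans Hi0.
apply: ler_wpM2l; first by rewrite mulr_ge0.
by rewrite lef_pV2 ?posrE ?exprn_gt0// ler_weXn2l// ler1n.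
Qed.

(** Banach's fixed point theorem for the family of seminorms
    sup (over t >= a) |phi t| / w t, indexed by a, all of which are halved by T.
    The seminorms may be infinite on the class M, hence the requirement that
    they are finite on differences of images of T; finite seminorms bring
    pointwise convergence of the iterates, and M must be closed under it. *)
Lemma weighted_contraction_fixpoint (R : realType) (I : Type) (w : R -> R)
    (M : (I -> R -> R) -> Prop) (T : (I -> R -> R) -> I -> R -> R)
    (phi0 : I -> R -> R) :
  M phi0 -> (forall phi, M phi -> M (T phi)) ->
  (forall (u : nat -> I -> R -> R) phi, (forall i, M (u i)) ->
     (forall k t, u i k t @[i --> \oo] --> phi k t) -> M phi) ->
  (forall t, 0 <= w t) ->
  (forall phi psi a, M phi -> M psi -> exists2 c, 0 <= c &
     forall k t, a <= t -> `|T phi k t - T psi k t| <= c * w t) ->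
  (forall phi psi a c, M phi -> M psi -> 0 <= c ->
     (forall k t, a <= t -> `|phi k t - psi k t| <= c * w t) ->
     forall k t, a <= t -> `|T phi k t - T psi k t| <= c / 2 * w t) ->
  exists! phi, M phi /\ T phi = phi.
Proof.
move=> M0 MT Mlim w0 Tbnd Tcontr.
(* The sequence starts at T phi0 because only differences of images of T have
   finite seminorms. *)
pose u i := iter i.+1 T phi0.
have Mu i : M (u i) by elim: i => [|i IH]; apply: MT.
have half_pow c i : c / 2 ^+ i / 2 = c / 2 ^+ i.+1 :> R.
  by rewrite -mulrA -invfM exprSr.
have step a : exists2 c, 0 <= c & forall i k t, a <= t ->
    `|u i.+1 k t - u i k t| <= c / 2 ^+ i * w t.
  have [c c0 Hc] := Tbnd (T phi0) phi0 a (MT _ M0) M0; exists c => //.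
  elim=> [|i IH] k t at_; first by rewrite expr0 divr1; exact: Hc.
  by rewrite -half_pow; apply: (Tcontr (u i.+1) (u i) a) => //; rewrite divr_ge0// exprn_ge0.
pose phi k t := limn (fun i => u i k t).
have rate a : exists2 c, 0 <= c & forall i k t, a <= t ->
    u i k t @[i --> \oo] --> phi k t /\ `|phi k t - u i k t| <= c / 2 ^+ i * w t.
  have [c c0 Hc] := step a; exists (2 * c); first by rewrite mulr_ge0.
  move=> i k t at_.
  have [j|l ul lu] := @geometric_steps_limit R (fun i => u i k t) (c * w t).
    by rewrite mulrAC; exact: Hc.
  have phil : phi k t = l by exact/cvg_lim.
  by rewrite phil; split => //; rewrite mulrAC -(mulrA 2); exact: lu.
have Mphi : M phi.
  apply: (Mlim u) => // k t; have [c _ Hc] := rate t.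
  by have [] := Hc 0%N k t (lexx t).
have Tphi : T phi = phi.
  apply/funext => k; apply/funext => t; have [c c0 Hc] := rate t.
  apply/eqP; rewrite -subr_eq0 -normr_le0.
  apply: (@geometric_bound_le0 _ _ (c * w t)) => i.
  have Hi : `|T phi k t - u i.+1 k t| <= c / 2 ^+ i / 2 * w t.
    apply: (Tcontr phi (u i) t) => //; first by rewrite divr_ge0// exprn_ge0.
    by move=> m z tz; have [] := Hc i m z tz.
  have [_] := Hc i.+1 k t (lexx t); rewrite -half_pow distrC => Hphi.
  rewrite -(subrKA (u i.+1 k t)); apply: le_trans (ler_normD _ _) _.
  by rewrite mulrAC; lra.
exists phi; split => // psi [Mpsi Tpsi]; apply/funext => k; apply/funext => t.
have [c c0 Hc] := Tbnd phi psi t Mphi Mpsi.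
apply/eqP; rewrite -subr_eq0 -normr_le0.
apply: (@geometric_bound_le0 _ _ (c * w t)) => i; rewrite mulrAC.
suff : forall m z, t <= z -> `|phi m z - psi m z| <= c / 2 ^+ i * w z.
  by apply.
elim: i => [|i IH] m z tz.
  by rewrite expr0 divr1 -[in phi m z]Tphi -[in psi m z]Tpsi; exact: Hc.
rewrite -half_pow -[in phi m z]Tphi -[in psi m z]Tpsi.
by apply: (Tcontr phi psi t) => //; rewrite divr_ge0// exprn_ge0.
Qed.

(** * The integral operator of the Cauchy co problem *)

Definition superposition (R : realType) (n N : nat) (G : 'I_n -> R -> 'M[R]_(n, N) -> R)
    (beta : 'I_n -> 'I_N -> R -> R) (phi : 'I_n -> R -> R) (k : 'I_n) (t : R) : R :=
  G k t (\matrix_(m < n, j < N) phi m (beta m j t)).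

(** The single formula covers both half-lines: beyond tau0 the integral is over
    an empty interval, and before tau0 the first term is s k tau0. *)
Definition picard (R : realType) (n N : nat) (tau0 : R)
    (G : 'I_n -> R -> 'M[R]_(n, N) -> R) (beta : 'I_n -> 'I_N -> R -> R)
    (s : 'I_n -> R -> R) (phi : 'I_n -> R -> R) (k : 'I_n) (t : R) : R :=
  s k (Num.max t tau0) - tail_integral tau0 (superposition G beta phi k) t.

Lemma within_continuous_max (R : realType) (c : R) (f : R -> R) :
  {within `[c, +oo[, continuous f} -> continuous (fun t => f (Num.max t c)).
Proof.
move=> /subspace_continuousP fc t.
have ct : c <= Num.max t c by rewrite le_max lexx orbT.
have mc : {for t, continuous (fun z : R => Num.max z c)}.
  by apply: (@continuous_max R R id (cst c) t); [exact: cvg_id | exact: cst_continuous].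
have /(fc _) {}fc : `[c, +oo[%classic (Num.max t c) by rewrite /= in_itv/= ct.
suff mw : Num.max z c @[z --> t] --> within `[c, +oo[ (nbhs (Num.max t c)).
  exact: cvg_comp mw fc.
move=> U nU.
have : \forall z \near t, `[c, +oo[%classic (Num.max z c) -> U (Num.max z c).
  exact: mc _ nU.
apply: filterS => z; apply.
by rewrite /= in_itv/= le_max lexx orbT.
Qed.

Lemma superposition_locally_integrable (R : realType) (n N : nat) (tau0 : R)
    (G : 'I_n -> R -> 'M[R]_(n, N) -> R) (beta : 'I_n -> 'I_N -> R -> R)
    (phi : 'I_n -> R -> R) :
  (forall k j, locally_lebesgue_measurable `]-oo, tau0] (beta k j)) ->
  (forall psi : 'I_n -> 'I_N -> R -> R,
    (forall m j, locally_lebesgue_measurable `]-oo, tau0] (psi m j)) ->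
    forall k, locally_lebesgue_integrable `]-oo, tau0]
      (fun t => G k t (\matrix_(m < n, j < N) psi m j t))) ->
  (forall m, measurable_fun setT (phi m)) ->
  forall k, locally_lebesgue_integrable `]-oo, tau0] (superposition G beta phi k).
Proof.
move=> mbeta LI mphi; apply: (LI (fun m j t => phi m (beta m j t))) => m j a b abD.
exact: measurableT_comp (mphi m) (mbeta m j a b abD).
Qed.

Lemma continuous_tail_bounded (R : realType) (tau0 a : R) (f : R -> R) :
  continuous f -> (forall t, tau0 <= t -> f t = 0) ->
  exists2 c, 0 <= c & forall t, a <= t -> `|f t| <= c.
Proof.
move=> fc f0; have mt : Num.min a tau0 <= tau0 by rewrite ge_min lexx orbT.
have [|c0 _ Hc] := @EVT_max R (fun t => `|f t|) _ _ mt.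
  apply: continuous_subspaceT => t.
  by apply: continuous_comp (fc t) _; exact: norm_continuous.
exists `|f c0| => // t at_.
have [t0|/ltW t0] := leP t tau0; last by rewrite f0// normr0.
by apply: Hc; rewrite in_itv/= t0 andbT ge_min at_.
Qed.

(** Nonnegativity of h is forced by the Lipschitz inequality as soon as two
    matrices at positive distance exist, that is, when n and N are positive. *)
Lemma lipschitz_modulus_ge0 (R : realType) (n N : nat) (tau0 : R)
    (G : 'I_n -> R -> 'M[R]_(n, N) -> R) (h : 'I_n -> R -> R) :
  (1 <= n)%N -> (1 <= N)%N ->
  (forall k (t : R) (u v : 'M[R]_(n, N)), t <= tau0 ->
     `|G k t u - G k t v| <=
       h k t * \sum_(m < n) \sum_(j < N) `|u m j - v m j|) ->
  forall k t, t <= tau0 -> 0 <= h k t.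
Proof.
move=> n1 N1 Lip k t t0; have := Lip k t (const_mx 1) 0 t0.
rewrite (eq_bigr (fun=> N%:R)); last first.
  move=> m _; rewrite (eq_bigr (fun=> 1)) ?sumr_const ?card_ord// => j _.
  by rewrite !mxE subr0 normr1.
rewrite sumr_const card_ord => /(le_trans (normr_ge0 _)).
by rewrite pmulr_lge0// -mulrnA ltr0n muln_gt0 N1.
Qed.

(** The sum of all the h i serves as a common modulus for all the components, so
    that a single weight can be used for the whole system. *)
Lemma superposition_lipschitz (R : realType) (n N : nat) (tau0 : R)
    (G : 'I_n -> R -> 'M[R]_(n, N) -> R) (beta : 'I_n -> 'I_N -> R -> R)
    (h : 'I_n -> R -> R) (phi psi : 'I_n -> R -> R) (k : 'I_n) (t d : R) :
  (forall k t, t <= tau0 -> 0 <= h k t) ->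
  (forall k (t : R) (u v : 'M[R]_(n, N)), t <= tau0 ->
     `|G k t u - G k t v| <=
       h k t * \sum_(m < n) \sum_(j < N) `|u m j - v m j|) ->
  t <= tau0 -> 0 <= d ->
  (forall m j, `|phi m (beta m j t) - psi m (beta m j t)| <= d) ->
  `|superposition G beta phi k t - superposition G beta psi k t| <=
  d * ((n * N)%:R * \sum_(i < n) h i t).
Proof.
move=> h0 Lip t0 d0 phipsi; apply: le_trans (Lip k t _ _ t0) _.
have -> : d * ((n * N)%:R * \sum_(i < n) h i t) =
    (\sum_(i < n) h i t) * (d *+ (n * N)) by rewrite mulrA mulrC mulr_natr.
apply: ler_pM; [exact: h0 | | |].
- by apply: sumr_ge0 => m _; apply: sumr_ge0.
- by rewrite (bigD1 k)//= lerDl; apply: sumr_ge0 => i _; exact: h0.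
- apply: (@le_trans _ _ (\sum_(m < n) \sum_(j < N) d)).
    by apply: ler_sum => m _; apply: ler_sum => j _; rewrite !mxE.
  rewrite (eq_bigr (fun=> d *+ N)) ?sumr_const ?card_ord -?mulrnA 1?mulnC//.
Qed.

Lemma picard_continuous (R : realType) (n N : nat) (tau0 : R)
    (G : 'I_n -> R -> 'M[R]_(n, N) -> R) (beta : 'I_n -> 'I_N -> R -> R)
    (s phi : 'I_n -> R -> R) (k : 'I_n) :
  {within `[tau0, +oo[, continuous (s k)} ->
  locally_lebesgue_integrable `]-oo, tau0] (superposition G beta phi k) ->
  continuous (picard tau0 G beta s phi k).
Proof.
move=> sc gint t; apply: (@continuousB R R^o R).
  exact: (within_continuous_max sc).
exact: tail_integral_continuous.
Qed.

Lemma picardB (R : realType) (n N : nat) (tau0 t : R)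
    (G : 'I_n -> R -> 'M[R]_(n, N) -> R) (beta : 'I_n -> 'I_N -> R -> R)
    (s phi psi : 'I_n -> R -> R) (k : 'I_n) :
  locally_lebesgue_integrable `]-oo, tau0] (superposition G beta phi k) ->
  locally_lebesgue_integrable `]-oo, tau0] (superposition G beta psi k) ->
  picard tau0 G beta s phi k t - picard tau0 G beta s psi k t =
  tail_integral tau0
    (superposition G beta psi k \- superposition G beta phi k) t.
Proof. by move=> int1 int2; rewrite tail_integralB// /picard; ring. Qed.

(** The advance is used twice: beta z >= z keeps the argument in [a, +oo[, and
    it makes the weight at beta z at most the weight at z. *)
Lemma picard_contraction (R : realType) (n N : nat) (tau0 : R)
    (G : 'I_n -> R -> 'M[R]_(n, N) -> R) (beta : 'I_n -> 'I_N -> R -> R)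
    (s : 'I_n -> R -> R) (h : 'I_n -> R -> R) (phi psi : 'I_n -> R -> R)
    (a c : R) :
  let H := fun t => (n * N)%:R * \sum_(k < n) h k t in
  (forall k, locally_lebesgue_integrable `]-oo, tau0] (superposition G beta phi k)) ->
  (forall k, locally_lebesgue_integrable `]-oo, tau0] (superposition G beta psi k)) ->
  (forall k, locally_lebesgue_integrable `]-oo, tau0] (h k)) ->
  (forall k t, t <= tau0 -> 0 <= h k t) ->
  (forall k (t : R) (u v : 'M[R]_(n, N)), t <= tau0 ->
     `|G k t u - G k t v| <=
       h k t * \sum_(m < n) \sum_(j < N) `|u m j - v m j|) ->
  (forall k j (t : R), t <= tau0 -> t <= beta k j t) ->
  0 <= c ->
  (forall k t, a <= t -> `|phi k t - psi k t| <= c * bielecki_weight tau0 H t) ->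
  forall k t, a <= t ->
    `|picard tau0 G beta s phi k t - picard tau0 G beta s psi k t| <=
    c / 2 * bielecki_weight tau0 H t.
Proof.
move=> H intphi intpsi hint h0 Lip adv c0 phipsi k t at_.
have Hint : locally_lebesgue_integrable `]-oo, tau0] H.
  exact: locally_lebesgue_integrable_sum.
have H0 z : z <= tau0 -> 0 <= H z.
  by move=> z0; rewrite mulr_ge0// sumr_ge0// => i _; exact: h0.
rewrite (picardB _ _ (intphi k) (intpsi k)).
apply: (tail_integral_weight_le
  (locally_lebesgue_integrableB (intpsi k) (intphi k)) Hint H0 c0 _ at_).
move=> z az z0; rewrite /= distrC.
have d0 : 0 <= c * bielecki_weight tau0 H z by rewrite mulr_ge0// expR_ge0.
apply: (superposition_lipschitz k h0 Lip z0 d0) => m j.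
have zb := adv m j z z0; apply: le_trans (phipsi m _ (le_trans az zb)) _.
apply: ler_wpM2l; first exact: c0.
by rewrite ler_expR ler_wpM2l//; exact: tail_integral_nonincreasing.
Qed.

Lemma picard_bounded (R : realType) (n N : nat) (tau0 a : R)
    (G : 'I_n -> R -> 'M[R]_(n, N) -> R) (beta : 'I_n -> 'I_N -> R -> R)
    (s phi psi : 'I_n -> R -> R) :
  (forall k, locally_lebesgue_integrable `]-oo, tau0] (superposition G beta phi k)) ->
  (forall k, locally_lebesgue_integrable `]-oo, tau0] (superposition G beta psi k)) ->
  exists2 c, 0 <= c & forall k t, a <= t ->
    `|picard tau0 G beta s phi k t - picard tau0 G beta s psi k t| <= c.
Proof.
move=> intphi intpsi.
have /choice[c Hc] : forall k, exists c, 0 <= c /\ forall t, a <= t ->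
    `|picard tau0 G beta s phi k t - picard tau0 G beta s psi k t| <= c.
  move=> k; have gint := locally_lebesgue_integrableB (intpsi k) (intphi k).
  have [c c0 Hc] := continuous_tail_bounded a (tail_integral_continuous gint)
    (fun t t0 => tail_integral_ge _ t0).
  exists c; split => // t at_.
  by rewrite (picardB _ _ (intphi k) (intpsi k)); exact: Hc.
exists (\sum_(k < n) c k); first by apply: sumr_ge0 => k _; have [] := Hc k.
move=> k t at_; have [_ /(_ t at_) /le_trans] := Hc k; apply.
by rewrite (bigD1 k)//= lerDl; apply: sumr_ge0 => i _; have [] := Hc i.
Qed.

(** * Solutions as fixed points *)

Lemma cauchy_co_solution_fixpoint (R : realType) (n N : nat) (tau0 : R)
    (G : 'I_n -> R -> 'M[R]_(n, N) -> R) (beta : 'I_n -> 'I_N -> R -> R)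
    (s phi : 'I_n -> R -> R) :
  (forall k, locally_lebesgue_integrable `]-oo, tau0] (superposition G beta phi k)) ->
  cauchy_co_solution tau0 G beta s phi -> picard tau0 G beta s phi = phi.
Proof.
move=> gint [_ phiAC dphi phis]; apply/funext => k; apply/funext => t.
rewrite /picard; have [t0|t0] := ltP t tau0; last first.
  by rewrite tail_integral_ge// subr0 phis.
apply/eqP; rewrite subr_eq; apply/eqP/esym.
set g := superposition G beta phi k.
have bad : (@lebesgue_measure R).-negligible
    [set z : R | [/\ t < z, z < tau0 &
      ~ is_derive z 1 (phi k \+ tail_integral tau0 g) 0]].
  apply: negligibleS (negligibleU ((negligible_completedP _).1 dphi)
    (tail_integral_ae_derive (gint k))).
  move=> z [_ z0 Nd] /=; apply: contrapT => /not_orP[/contrapT dz Jz].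
  apply: Nd; have dJ : is_derive z 1 (tail_integral tau0 g) (- g z).
    by apply: contrapT => NdJ; apply: Jz; split.
  by rewrite -(subrr (g z)); apply: is_deriveD => //; exact: dz (ltW z0) k.
have fAC : absolutely_continuous_on t tau0 (phi k \+ tail_integral tau0 g).
  apply: absolutely_continuousD.
    by apply: phiAC => z; rewrite /= !in_itv/= => /andP[].
  exact: (tail_integral_absolutely_continuous _ _ (gint k)).
have := absolutely_continuous_derive0 (ltW t0) fAC bad.
by rewrite /= (tail_integral_ge _ (lexx tau0)) addr0 (phis k tau0 (lexx _)).
Qed.

Lemma fixpoint_cauchy_co_solution (R : realType) (n N : nat) (tau0 : R)
    (G : 'I_n -> R -> 'M[R]_(n, N) -> R) (beta : 'I_n -> 'I_N -> R -> R)
    (s phi : 'I_n -> R -> R) :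
  (forall k, {within `[tau0, +oo[, continuous (s k)}) ->
  (forall k, locally_lebesgue_integrable `]-oo, tau0] (superposition G beta phi k)) ->
  picard tau0 G beta s phi = phi -> cauchy_co_solution tau0 G beta s phi.
Proof.
move=> sc gint fixphi.
have phiE k t : t <= tau0 -> phi k t =
    s k tau0 - tail_integral tau0 (superposition G beta phi k) t.
  by move=> t0; rewrite -[in LHS]fixphi /picard max_r.
split.
- by move=> k; rewrite -fixphi; exact: picard_continuous.
- move=> k a b ab0 e e0.
  have [d d0 Hd] := tail_integral_absolutely_continuous a b (gint k) e0.
  exists d => // m x y xy tI /(Hd _ _ _ xy tI); apply: le_lt_trans.
  apply: ler_sum => i _; have [ax xyi yb] := xy i.
  have yi0 : y i <= tau0.
    have : `[a, b]%classic (y i) by rewrite /= in_itv/= yb (le_trans ax).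
    by move=> /ab0; rewrite /= in_itv.
  rewrite !phiE//; last exact: le_trans yi0.
  by rewrite opprB addrC subrKA distrC.
- suff dphi k : {ae (@completed_lebesgue_measure R), forall t : R, t <= tau0 ->
      is_derive t 1 (phi k) (superposition G beta phi k t)}.
    have := @filter_forall _ _ _ _
      (ae_filter_ringOfSetsType (@completed_lebesgue_measure R)) dphi.
    by apply: filterS => t Ht t0 k; exact: Ht.
  apply/negligible_completedP.
  (* At tau0 itself phi may have a kink, depending on the slope of s. *)
  have neg1 : (@lebesgue_measure R).-negligible [set tau0].
    exists [set tau0]; split; [exact: measurable_set1 | | by []].
    exact: lebesgue_measure_set1.
  apply: negligibleS (negligibleU neg1 (tail_integral_ae_derive (gint k))).
  move=> t /= /not_implyP[t0 Nd].
  have [->|tne] := eqVneq t tau0; [by left | right].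
  have t_lt : t < tau0 by rewrite lt_neqAle tne.
  split => // dJ; apply: Nd.
  apply: (@near_eq_is_derive _ _ _
    (cst (s k tau0) - tail_integral tau0 (superposition G beta phi k))).
    (* phiE holds near t because t lies strictly before tau0. *)
    by near=> z; rewrite phiE//; apply/ltW; near: z; exact: lt_nbhsl.
  by rewrite -[superposition _ _ _ _ _]opprK -sub0r; apply: is_deriveB.
- move=> k t t0; rewrite -[in LHS]fixphi /picard tail_integral_ge// subr0.
  by rewrite max_l.
Unshelve. all: by end_near. Qed.

Theorem theorem3p2 (R : realType) (n N : nat) (tau0 : R)
    (G : 'I_n -> R -> 'M[R]_(n, N) -> R)
    (beta : 'I_n -> 'I_N -> R -> R) (s : 'I_n -> R -> R) :
  (1 <= n)%N -> (1 <= N)%N ->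
  (forall k (u : 'M[R]_(n, N)),
    locally_lebesgue_integrable `]-oo, tau0] (fun t => G k t u)) ->
  (forall k (t : R), t <= tau0 -> continuous (G k t)) ->
  (forall k j, locally_lebesgue_measurable `]-oo, tau0] (beta k j)) ->
  (forall k, {within `[tau0, +oo[, continuous (s k)}) ->
  (* (L* ) *)
  (exists h : 'I_n -> R -> R,
    (forall k, locally_lebesgue_integrable `]-oo, tau0] (h k)) /\
    forall k (t : R) (u v : 'M[R]_(n, N)), t <= tau0 ->
      `|G k t u - G k t v| <=
        h k t * \sum_(m < n) \sum_(j < N) `|u m j - v m j|) ->
  (* (LI* ) *)
  (forall psi : 'I_n -> 'I_N -> R -> R,
    (forall m j, locally_lebesgue_measurable `]-oo, tau0] (psi m j)) ->
    forall k, locally_lebesgue_integrable `]-oo, tau0]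
      (fun t => G k t (\matrix_(m < n, j < N) psi m j t))) ->
  (* (Adv) *)
  (forall k j (t : R), t <= tau0 -> t <= beta k j t) ->
  exists! phi : 'I_n -> R -> R, cauchy_co_solution tau0 G beta s phi.
Proof.
move=> n1 N1 _ _ mbeta sc [h [hint Lip]] LI adv.
have h0 := lipschitz_modulus_ge0 n1 N1 Lip.
pose M (phi : 'I_n -> R -> R) := forall m, measurable_fun setT (phi m).
have gint phi : M phi -> forall k,
    locally_lebesgue_integrable `]-oo, tau0] (superposition G beta phi k).
  by move=> Mphi; exact: superposition_locally_integrable.
pose H t := (n * N)%:R * \sum_(k < n) h k t.
have H0 t : t <= tau0 -> 0 <= H t.
  by move=> t0; rewrite mulr_ge0// sumr_ge0// => k _; exact: h0.
have [phi [[Mphi phiE] uniq]] :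
    exists! phi, M phi /\ picard tau0 G beta s phi = phi.
  apply: (@weighted_contraction_fixpoint R 'I_n (bielecki_weight tau0 H) M
    (picard tau0 G beta s) (fun _ _ => 0)).
  - by move=> m; exact: measurable_cst.
  - move=> phi Mphi m; apply: continuous_measurable_fun.
    exact: picard_continuous (sc m) (gint phi Mphi m).
  - move=> u phi Mu uphi m; apply: measurable_fun_cvg => [i|t _].
      exact: Mu i m.
    exact: uphi.
  - by move=> t; exact: expR_ge0.
  - move=> phi psi a Mphi Mpsi.
    have [c c0 Hc] := picard_bounded a s (gint _ Mphi) (gint _ Mpsi).
    exists c => // k t at_; apply: le_trans (Hc k t at_) _.
    by rewrite ler_peMr// bielecki_weight_ge1.
  - move=> phi psi a c Mphi Mpsi c0.
    exact: picard_contraction (gint _ Mphi) (gint _ Mpsi) hint h0 Lip adv c0.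
exists phi; split; first exact: fixpoint_cauchy_co_solution (gint _ Mphi) phiE.
move=> psi sol; have [psic _ _ _] := sol.
have Mpsi : M psi by move=> m; apply: continuous_measurable_fun; exact: psic.
by apply: uniq; split => //; exact: cauchy_co_solution_fixpoint (gint _ Mpsi) sol.
Qed.
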